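(* Let $f:V\to\mathbb R\cup\{+\infty\}$ be in $\mathcal S^0_\mu$ with $\mu\geqslant 0$, and let $x^*$ be a global minimizer of $f$. Let $x_0\in V$, $\gamma_0>0$, let $\alpha_k>0$ ($k\geqslant 0$) be arbitrary, and define $\{(x_k,\gamma_k)\}$ by the scheme $$\frac{x_{k+1}-x_k}{\alpha_k}\in-\frac1{\gamma_k}\partial f(x_{k+1}),\qquad \frac{\gamma_{k+1}-\gamma_k}{\alpha_k}=\mu-\gamma_{k+1},$$ that is, $x_{k+1}=\mathbf{prox}_{t_kf}(x_k)$ with $t_k=\alpha_k/\gamma_k$. Set $\mathcal L_k=f(x_k)-f(x^* )+\frac{\gamma_k}2\|x_k-x^*\|^2$. Then $$\mathcal L_{k+1}\leqslant\frac1{1+\alpha_k}\mathcal L_k\qquad\forall\,k\geqslant 0.$$ Consequently, for any $\gamma_0>0$ and all $k\geqslant 0$, $$\mathcal L_k\leqslant\frac{\mathcal L_0}{1+\gamma_0\left[\prod_{i=0}^{k-1}(1+t_i\mu)-1\right]/\mu},$$ where for $\mu=0$ the convention $\frac1\mu\left[\prod_{i=0}^{k-1}(1+t_i\mu)-1\right]:=\sum_{i=0}^{k-1}t_i$ is used.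
   Context: $V$ is a real Hilbert space with norm $\|\cdot\|$, identified with its dual by the Riesz map (so subgradients are elements of $V$). $\mathcal S^0_\mu$ is the set of proper closed functions $f:V\to\mathbb R\cup\{+\infty\}$ that are $\mu$-strongly convex if $\mu>0$, i.e. $f(\alpha x+(1-\alpha)y)\leqslant\alpha f(x)+(1-\alpha)f(y)-\frac\mu2\alpha(1-\alpha)\|x-y\|^2$ for all $x,y\in\operatorname{dom}f$, $\alpha\in[0,1]$, and convex if $\mu=0$. $\partial f$ is the convex subdifferential. $\mathbf{prox}_{tf}(z)=\operatorname{argmin}_x\{f(x)+\frac1{2t}\|x-z\|^2\}$. Inequalities are understood in $(-\infty,+\infty]$ if $f(x_0)=+\infty$. The existence of a global minimizer $x^*$ is a standing assumption. *)

(* Defs.v *)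
From HB Require Import structures.
From mathcomp Require Import all_boot all_order all_algebra.
From mathcomp Require Import sesquilinear.
From mathcomp Require Import all_classical all_reals all_analysis.

Set Implicit Arguments.
Unset Strict Implicit.
Unset Printing Implicit Defensive.

Import Order.TTheory GRing.Theory Num.Theory.
Import numFieldNormedType.Exports.

Local Open Scope classical_set_scope.
Local Open Scope ring_scope.
Local Open Scope ereal_scope.

Section ConvexAnalysis.
Context {R : realType} {V : completeNormedModType R}.
Implicit Types (f : V -> \bar R) (mu t : R) (x z : V).

Definition edom f : set V := [set x | f x < +oo].

Definition proper_fun f : Prop :=
  (forall x, f x != -oo) /\ edom f !=set0.

Definition closed_fun f : Prop :=
  closed [set p : V * R | f p.1 <= p.2%:E].

Definition convex_efun f : Prop :=
  forall x y (a : R), edom f x -> edom f y -> (0 <= a <= 1)%R ->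
  f (a *: x + (1 - a) *: y)%R <= a%:E * f x + (1 - a)%:E * f y.

Definition strongly_convex_efun mu f : Prop :=
  forall x y (a : R), edom f x -> edom f y -> (0 <= a <= 1)%R ->
  f (a *: x + (1 - a) *: y)%R <=
    a%:E * f x + (1 - a)%:E * f y
    - (mu / 2 * a * (1 - a) * `|x - y| ^+ 2)%:E.

(** The class $\mathcal S^0_\mu$, for $\mu \ge 0$. *)
Definition class_S0 mu f : Prop :=
  [/\ proper_fun f, closed_fun f,
      (0 < mu)%R -> strongly_convex_efun mu f &
      mu = 0%R -> convex_efun f].

(** Subgradients are vectors through the Riesz identification given by the
    inner product [ip].  For a proper [f] the set is empty off [edom f]. *)
Definition subdifferential (ip : V -> V -> R) f x : set V :=
  [set xi | forall y, f x + (ip xi (y - x)%R)%:E <= f y].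

Definition global_minimizer f x : Prop := forall y, f x <= f y.

(** The set of minimizers of $f + \frac1{2t}\|\cdot - z\|^2$; the equation
    $p = \mathbf{prox}_{tf}(z)$ is rendered as [prox t f z = [set p]]. *)
Definition prox t f z : set V :=
  [set p | global_minimizer
             (fun y => f y + ((2 * t)^-1 * `|y - z| ^+ 2)%:E) p].

Definition lyapunov f (xstar : V) (gamma : R) x : \bar R :=
  f x - f xstar + (gamma / 2 * `|x - xstar| ^+ 2)%:E.

(** $\frac1\mu [\prod_{i<k} (1 + t_i \mu) - 1]$, read as $\sum_{i<k} t_i$ when
    $\mu = 0$. *)
Definition growth mu (t : nat -> R) (k : nat) : R :=
  if mu == 0%R then (\sum_(0 <= i < k) t i)%R
  else ((\prod_(0 <= i < k) (1 + t i * mu) - 1) / mu)%R.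

End ConvexAnalysis.

(* Main.v *)
(** Strong convexity upgrades the subgradient inequality at $p = x_{k+1}$ to
    $f(y) \ge f(p) + \langle \xi, y - p\rangle + \frac\mu2 \|y - p\|^2$. Adding
    this for $y = x_k$ (without the quadratic term) to $\alpha_k$ times the one
    for $y = x^*$, with $\xi = -(\gamma_k/\alpha_k)(p - x_k)$ and
    $(1 + \alpha_k)\gamma_{k+1} = \gamma_k + \alpha_k\mu$, the cosine rule leaves
    $(1 + \alpha_k)\mathcal L_{k+1} - \mathcal L_k \le
    -(\gamma_k/\alpha_k + \gamma_k/2)\|p - x_k\|^2$.  The explicit rate comes from
    $\gamma_{k+1}(1 + \alpha_k) = \gamma_k(1 + t_k\mu)$, which makes
    $\prod_{i<k}(1 + \alpha_i)$ grow by $\gamma_0 t_k \prod_{i<k}(1 + t_i\mu)$ at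
    step $k$. *)

Require Import Defs.
From HB Require Import structures.
From mathcomp Require Import all_boot all_order all_algebra.
From mathcomp Require Import sesquilinear.
From mathcomp Require Import all_classical all_reals all_analysis.
From mathcomp Require Import ring lra.

Set Implicit Arguments.
Unset Strict Implicit.
Unset Printing Implicit Defensive.

Import Order.TTheory GRing.Theory Num.Theory.
Import numFieldNormedType.Exports.

Local Open Scope classical_set_scope.
Local Open Scope ring_scope.

Lemma ge0_affine_right0 (R : realFieldType) (b c : R) :
  (forall s, 0 < s < 1 -> 0 <= b + s * c) -> 0 <= b.
Proof.
move=> bc; have [//|b_lt0] := lerP 0 b.
(* With this [s], [s * c <= s * |c| = - b + 2 * s * b], so [b + s * c <= 2 * s * b < 0], a
   contradiction. *)
pose s := - b / (`|c| - 2 * b).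
have d_gt0 : 0 < `|c| - 2 * b by have := normr_ge0 c; lra.
have s_gt0 : 0 < s by rewrite divr_gt0 // oppr_gt0.
have s_lt1 : s < 1.
  by rewrite ltr_pdivrMr // mul1r; have := normr_ge0 c; lra.
have sd : s * (`|c| - 2 * b) = - b by rewrite divfK // gt_eqF.
have sc : s * c <= s * `|c| by rewrite ler_pM2l // ler_norm.
have := bc s; rewrite s_gt0 s_lt1 => /(_ isT).
by have : s * b < 0; [rewrite pmulr_rlt0|nra].
Qed.

Section InnerProduct.
Context {R : realType} {V : completeNormedModType R}.
Context (ip : {dot V for @idfun R}).
Context (ip_norm : forall v : V, ip v v = `|v| ^+ 2).

Lemma ipC u v : ip u v = ip v u.
Proof. by rewrite hermC expr0 mul1r. Qed.

Lemma sqr_normD u v : `|u + v| ^+ 2 = `|u| ^+ 2 + 2 * ip u v + `|v| ^+ 2.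
Proof. by rewrite -!ip_norm linearDl !linearDr/= (ipC v u); ring. Qed.

Lemma ip_scalel a u v : ip (a *: u) v = a * ip u v.
Proof. by rewrite linearZl_LR. Qed.

Lemma ip_scaler a u v : ip u (a *: v) = a * ip u v.
Proof. by rewrite linearZr_LR. Qed.

Lemma sqr_norm_cosine p y z :
  `|y - z| ^+ 2 = `|p - z| ^+ 2 + 2 * ip (p - z) (y - p) + `|y - p| ^+ 2.
Proof. by rewrite -sqr_normD (addrC (p - z)) subrKA. Qed.

Lemma proper_fin (f : V -> \bar R) x :
  proper_fun f -> edom f x -> exists r, f x = r%:E.
Proof.
move=> [fN _]; rewrite /edom/= => fx; have := fN x.
by case: (f x) fx => // r _ _; exists r.
Qed.

Lemma subdifferential_edom (f : V -> \bar R) p :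
  proper_fun f -> subdifferential ip f p !=set0 -> edom f p.
Proof.
move=> [fN [y fy]] [xi /(_ y)]; have := fN p.
rewrite /edom/= ltey; case: (f p) => //= _ le_fy.
by move: fy; rewrite /edom/= ltNge le_fy.
Qed.

Lemma global_minimizer_edom (f : V -> \bar R) p :
  proper_fun f -> global_minimizer f p -> edom f p.
Proof. by move=> [_ [y fy]] pmin; exact: le_lt_trans (pmin y) fy. Qed.

(** Treats both convexity clauses of [class_S0] at once, since the quadratic term vanishes at
    [mu = 0]. Parametrizing from [p] prepares first-order comparisons as [s] tends to 0. *)
Lemma class_S0_segment mu (f : V -> \bar R) p y (u v s : R) :
  0 <= mu -> class_S0 mu f -> f p = u%:E -> f y = v%:E -> 0 <= s <= 1 ->
  (f (p + s *: (y - p))%R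
     <= (u + s * (v - u) - mu / 2 * s * (1 - s) * `|y - p| ^+ 2)%:E)%E.
Proof.
move=> mu_ge0 [_ _ fsc fc] fp fy s01.
have dp : edom f p by rewrite /edom/= fp ltry.
have dy : edom f y by rewrite /edom/= fy ltry.
have -> : p + s *: (y - p) = s *: y + (1 - s) *: p.
  by rewrite scalerBl scale1r scalerBr addrCA addrA addrC.
move: mu_ge0; rewrite le0r => /orP[/eqP mu0|mu_gt0].
  apply: le_trans (fc mu0 _ _ _ dy dp s01) _.
  by rewrite fp fy -!EFinM -EFinD lee_fin mu0; lra.
apply: le_trans (fsc mu_gt0 _ _ _ dy dp s01) _.
by rewrite fp fy -!EFinM -!EFinD lee_fin; lra.
Qed.

Lemma subdifferential_strong mu (f : V -> \bar R) p y xi (u v : R) :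
  0 <= mu -> class_S0 mu f -> subdifferential ip f p xi ->
  f p = u%:E -> f y = v%:E ->
  u + ip xi (y - p) + mu / 2 * `|y - p| ^+ 2 <= v.
Proof.
move=> mu_ge0 fS xiP fp fy; rewrite -subr_ge0.
(* The subgradient inequality at [p + s *: (y - p)] is compared with the segment bound and divided
   by [s]; the slope in [s] comes from the factor [1 - s]. *)
apply: (@ge0_affine_right0 _ _ (mu / 2 * `|y - p| ^+ 2)) => s /andP[s_gt0 s_lt1].
have s01 : 0 <= s <= 1 by rewrite !ltW.
have := le_trans (xiP _) (class_S0_segment mu_ge0 fS fp fy s01).
rewrite fp (addrC p) addrK ip_scaler -EFinD lee_fin => le_s.
by rewrite -(pmulr_rge0 _ s_gt0); lra.
Qed.

Lemma subdifferential_prox mu (f : V -> \bar R) (t : R) z p :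
  0 <= mu -> class_S0 mu f -> 0 < t ->
  subdifferential ip f p (- t^-1 *: (p - z)) <-> prox t f z = [set p].
Proof.
move=> mu_ge0 fS t_gt0; have [fP _ _ _] := fS.
have tE : (2 * t)^-1 = t^-1 / 2 by rewrite invfM mulrC.
have tV_gt0 : 0 < t^-1 by rewrite invr_gt0.
split=> [pS|pE].
  have /(proper_fin fP)[u fp] : edom f p.
    by apply: subdifferential_edom => //; exists (- t^-1 *: (p - z)).
  (* The subgradient term cancels the cross term of the cosine rule, leaving a quadratic gap that
     yields both minimality and uniqueness of [p]. *)
  have gap y : (f p + ((2 * t)^-1 * `|p - z| ^+ 2)%:E +
      ((2 * t)^-1 * `|y - p| ^+ 2)%:E <= f y + ((2 * t)^-1 * `|y - z| ^+ 2)%:E)%E.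
    have := pS y; rewrite fp ip_scalel.
    case: (f y) => [v||//]; last by rewrite addye ?leey.
    by rewrite -!EFinD !lee_fin (sqr_norm_cosine p y z) tE; lra.
  apply/seteqP; split=> [q /= qmin|_ -> y]; last first.
    apply: le_trans (gap y); rewrite leeDl// lee_fin.
    by rewrite mulr_ge0 ?sqr_ge0// invr_ge0 mulr_ge0// ltW.
  have := le_trans (gap q) (qmin p).
  rewrite fp -!EFinD lee_fin gerDl pmulr_rle0 ?invr_gt0 ?mulr_gt0//.
  by rewrite exprn_even_le0//= normr_eq0 subr_eq0 => /eqP.
have pmin : prox t f z p by rewrite pE.
have /(proper_fin fP)[u fp] : edom f p.
  have [_ [y fy]] := fP; have := pmin y; have := fP.1 p.
  rewrite /edom/= ltey; case: (f p) => //= _.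
  by move: fy; rewrite /edom/=; case: (f y).
move=> y; rewrite fp; have := fP.1 y.
case fy: (f y) => [v||//] _; last by rewrite leey.
rewrite -EFinD lee_fin ip_scalel -subr_ge0.
(* Minimality of [p] is tested along the segment towards [y]; the slope is the [s ^+ 2] term of the
   proximal quadratic divided by [s], and the strong convexity gain has the favourable sign. *)
apply: (@ge0_affine_right0 _ _ (t^-1 / 2 * `|y - p| ^+ 2)) => s /andP[s_gt0 s_lt1].
have s01 : 0 <= s <= 1 by rewrite !ltW.
have le_s := class_S0_segment mu_ge0 fS fp fy s01.
have := le_trans (pmin _) (leeD le_s (lexx _)).
rewrite fp -!EFinD lee_fin (sqr_norm_cosine p (p + _)) (addrC p (s *: _)) addrK ip_scaler.
rewrite normrZ exprMn real_normK ?num_real// tE => {}le_s.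
rewrite -(pmulr_rge0 _ s_gt0).
have : 0 <= mu / 2 * s * (1 - s) * `|y - p| ^+ 2.
  by rewrite !mulr_ge0 ?sqr_ge0 ?invr_ge0 ?subr_ge0// ltW.
by lra.
Qed.

Lemma lyapunov_prox_step mu (f : V -> \bar R) xstar g g' a z p :
  0 <= mu -> class_S0 mu f -> global_minimizer f xstar ->
  0 < g -> 0 < a -> (1 + a) * g' = g + a * mu ->
  subdifferential ip f p (- (a / g)^-1 *: (p - z)) ->
  (lyapunov f xstar g' p <= (1 / (1 + a))%:E * lyapunov f xstar g z)%E.
Proof.
move=> mu_ge0 fS xmin g_gt0 a_gt0 g'E pS; have [fP _ _ _] := fS.
have [m fm] := proper_fin fP (global_minimizer_edom fP xmin).
have /(proper_fin fP)[u fp] : edom f p.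
  by apply: subdifferential_edom => //; exists (- (a / g)^-1 *: (p - z)).
have a1_gt0 : 0 < 1 + a by rewrite ltr_wpDl.
rewrite muleC mul1r lee_pdivlMr// /lyapunov fm fp.
(* A starting point outside the domain makes the right-hand side [+oo]. *)
have := fP.1 z; case fz: (f z) => [w||//] _; last first.
  by rewrite !addye// leey.
rewrite -!EFinB -!EFinD -EFinM lee_fin.
have := subdifferential_strong mu_ge0 fS pS fp fm.
have := pS z; rewrite fz fp -EFinD lee_fin !ip_scalel invf_div.
have -> : ip (p - z) (z - p) = - `|p - z| ^+ 2.
  by rewrite -(opprB p z) linearNr/= ip_norm.
rewrite (distrC z xstar) (sqr_norm_cosine p xstar z) !(distrC xstar p).
set A := `|p - z| ^+ 2; set B := `|p - xstar| ^+ 2; set C := ip _ _ => h1 h2.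
have A_ge0 : 0 <= A by rewrite sqr_ge0.
have gaA : 0 <= g / a * A by rewrite mulr_ge0// divr_ge0// ltW.
have gA : 0 <= g * A by rewrite mulr_ge0// ltW.
have ag : a * (g / a) = g by rewrite mulrCA divff ?mulr1// gt_eqF.
(* Scaling by [a] turns the coefficient [g / a] of [C] into [g], matching the cross term of
   [g / 2 * |xstar - z| ^+ 2]. *)
have := ler_wpM2l (ltW a_gt0) h2.
rewrite !mulrDr !mulNr mulrN (mulrA a (g / a)) ag => {}h2.
have g'B : (1 + a) * (g' / 2 * B) = (g + a * mu) / 2 * B by rewrite -g'E; ring.
lra.
Qed.

End InnerProduct.

(** Gives both branches of [growth] one recursion: the product is 1 when [mu = 0], and otherwise the
    factor [mu] in the increment cancels the denominator. *)
Lemma growthS (R : realType) (mu : R) (t : nat -> R) k :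
  growth mu t k.+1 = growth mu t k + t k * \prod_(0 <= i < k) (1 + t i * mu).
Proof.
rewrite /growth; have [->|mu0] := eqVneq mu 0.
  by rewrite big_nat_recr//= [X in _ * X]big1 ?mulr1// => i _; rewrite mulr0 addr0.
by rewrite big_nat_recr//=; field.
Qed.

Lemma prod_stepsE (R : realType) (mu : R) (gamma alpha : nat -> R) k :
  (forall k, 0 < gamma k) ->
  (forall k, (1 + alpha k) * gamma k.+1 = gamma k + alpha k * mu) ->
  \prod_(0 <= i < k) (1 + alpha i) =
    1 + gamma 0%N * growth mu (fun i => alpha i / gamma i) k.
Proof.
move=> g_gt0 gE; set t := (fun i => alpha i / gamma i).
have tg i : t i * gamma i = alpha i by rewrite divfK// gt_eqF.
(* Telescopes [gamma n.+1 * (1 + alpha n) = gamma n * (1 + t n * mu)]. *)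
have gP n : gamma n * \prod_(0 <= i < n) (1 + alpha i) =
    gamma 0%N * \prod_(0 <= i < n) (1 + t i * mu).
  elim: n => [|n IHn]; first by rewrite !big_nil.
  rewrite !big_nat_recr//= [RHS]mulrA -IHn.
  have -> : gamma n.+1 * (\prod_(0 <= i < n) (1 + alpha i) * (1 + alpha n)) =
      (1 + alpha n) * gamma n.+1 * \prod_(0 <= i < n) (1 + alpha i) by ring.
  by rewrite gE -{1}tg; ring.
elim: k => [|k IHk].
  rewrite big_nil /growth; case: ifP => _.
    by rewrite big_nil mulr0 addr0.
  by rewrite big_nil subrr mul0r mulr0 addr0.
by rewrite big_nat_recr//= growthS [in RHS]mulrDr addrA -IHk mulrCA -gP -(tg k); ring.
Qed.

Theorem theorem5p1 (R : realType) (V : completeNormedModType R)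
    (ip : {dot V for @idfun R})
    (ip_norm : forall v : V, ip v v = `|v| ^+ 2)
    (mu : R) (mu_ge0 : 0 <= mu)
    (f : V -> \bar R) (fS : class_S0 mu f)
    (xstar : V) (xstar_min : global_minimizer f xstar)
    (x : nat -> V) (gamma alpha : nat -> R)
    (gamma0_gt0 : 0 < gamma 0%N)
    (alpha_gt0 : forall k, 0 < alpha k)
    (x_step : forall k,
      [set - (gamma k)^-1 *: xi | xi in subdifferential ip f (x k.+1)]
        ((alpha k)^-1 *: (x k.+1 - x k)))
    (gamma_step : forall k,
      (gamma k.+1 - gamma k) / alpha k = mu - gamma k.+1) :
  let t := fun k => alpha k / gamma k in
  let L := fun k => lyapunov f xstar (gamma k) (x k) in
  [/\ forall k (p : V),
        [set - (gamma k)^-1 *: xi | xi in subdifferential ip f p]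
          ((alpha k)^-1 *: (p - x k)) <->
        prox (t k) f (x k) = [set p],
      forall k, (L k.+1 <= (1 / (1 + alpha k))%:E * L k)%E &
      forall k,
        (L k <= L 0%N * ((1 + gamma 0%N * growth mu t k)^-1)%:E)%E].
Proof.
move=> t L.
have gE k : (1 + alpha k) * gamma k.+1 = gamma k + alpha k * mu.
  have := gamma_step k; move/(congr1 ( *%R^~ (alpha k))).
  by rewrite divfK ?gt_eqF//; lra.
(* Each [gamma k.+1] is a weighted average of [gamma k] and [mu], with positive weight on
   [gamma k]. *)
have g_gt0 k : 0 < gamma k.
  elim: k => // k IHk; have a1 : 0 < 1 + alpha k by rewrite ltr_wpDl.
  by rewrite -(pmulr_rgt0 _ a1) gE ltr_wpDr// mulr_ge0// ltW.
have stepE k p : [set - (gamma k)^-1 *: xi | xi in subdifferential ip f p]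
      ((alpha k)^-1 *: (p - x k)) <->
    subdifferential ip f p (- (t k)^-1 *: (p - x k)).
  have g0 : gamma k != 0 by rewrite gt_eqF.
  have a0 : alpha k != 0 by rewrite gt_eqF.
  split=> [[xi xiP /(congr1 ( *:%R (- gamma k)))]|pS].
    rewrite !scalerA mulrNN divff// scale1r mulNr => xiE.
    by rewrite /t invf_div -xiE.
  exists (- (t k)^-1 *: (p - x k)) => //.
  by rewrite scalerA mulrNN /t invf_div mulKf.
have Lstep k : (L k.+1 <= (1 / (1 + alpha k))%:E * L k)%E.
  exact: (lyapunov_prox_step ip_norm mu_ge0 fS xstar_min (g_gt0 k) (alpha_gt0 k) (gE k) (iffLR (stepE _ _) (x_step k))).
split=> // [k p|k].
  apply: (iff_trans (stepE k p)); apply: (subdifferential_prox ip_norm _ _ mu_ge0 fS).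
  by rewrite divr_gt0.
(* With the denominator written as the product of the [1 + alpha i], the rate is the one-step
   contraction iterated. *)
rewrite -prod_stepsE//; elim: k => [|k IHk].
  by rewrite big_nil invr1 mule1.
have a1 : 0 < 1 + alpha k by rewrite ltr_wpDl.
apply: le_trans (Lstep k) _.
rewrite muleC mul1r big_nat_recr//= invfM EFinM muleA.
by apply: lee_wpmul2r IHk; rewrite lee_fin invr_ge0 ltW.
Qed.
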